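(* Let $G$ be a finite group and let $\mathcal C(G)$ be its Cayley machine. Then for every $n\ge 1$ the minimal transducer representing the $n$-th power $\mathcal C(G)^n$ has exactly $|G|^n$ states, i.e. $|\mathcal C(G)^n|=|G|^n$; hence the automaton $\mathcal C(G)$ has growth rate $|G|^n$. Moreover every state of $\mathcal C(G)^n$ is accessible from every other state.
   Context: The Cayley machine of $G$ is the synchronous transducer $\mathcal C(G)=\langle G,G,\pi,\lambda\rangle$ with input/output alphabet $G$, state set $G$, and $\pi(l,m)=ml$, $\lambda(l,m)=ml$ for a letter $l\in G$ read from the state $m\in G$. For synchronous transducers $A,B$ over the same alphabet, with transition and output functions $\pi_A,\lambda_A,\pi_B,\lambda_B$, the product $A*B$ has state set $Q_A\times Q_B$ and $\pi_{A*B}(x,(p,q))=(\pi_A(x,p),\pi_B(\lambda_A(x,p),q))$, $\lambda_{A*B}(x,(p,q))=\lambda_B(\lambda_A(x,p),q)$; $\mathcal C(G)^n$ is the $n$-fold product $\mathcal C(G)*\cdots*\mathcal C(G)$, with state set $G^n$. Two states are $\omega$-equivalent if they induce the same map on infinite words over $G$; the minimal transducer is obtained by identifying $\omega$-equivalent states, and $|\mathcal C(G)^n|$ denotes its number of states (the growth rate of $\mathcal C(G)$ is the function $n\mapsto|\mathcal C(G)^n|$). A state $t$ is accessible from a state $s$ if some finite input word is read from $s$ into $t$. *)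

(* Defs.v *)
From HB Require Import structures.
From mathcomp Require Import all_boot all_fingroup.
From mathcomp Require Import generic_quotient boolp.

Set Implicit Arguments.
Unset Strict Implicit.
Unset Printing Implicit Defensive.

Local Open Scope quotient_scope.

(* Synchronous transducers with input and output alphabet [X]: [trans] is the
   transition function pi, [out] the output function lambda. *)
Record transducer (X : finType) := Transducer {
  state : finType;
  trans : X -> state -> state;
  out : X -> state -> X
}.
Arguments Transducer {X} state trans out.
Arguments trans {X t} x q.
Arguments out {X t} x q.

Section Transducers.

Variable X : finType.
Implicit Types A B : transducer X.

Definition tprod A B : transducer X :=
  Transducer (state A * state B)%type
    (fun x pq => (trans x pq.1, trans (out x pq.1) pq.2))
    (fun x pq => out (out x pq.1) pq.2).

Definition tid : transducer X := Transducer unit (fun _ q => q) (fun x _ => x).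

(* [tpow A n.+1] is [A * (A * ... * (A * A))] with [n.+1] factors, and no
   trivial factor; [tpow A 0] is the identity transducer, by convention. *)
Definition tpow A n : transducer X := iterop n tprod A tid.

Definition accessible A (s t : state A) : Prop :=
  exists w : seq X, foldl (fun q x => trans x q) s w = t.

Fixpoint state_at A (q : state A) (w : nat -> X) (k : nat) : state A :=
  if k is k'.+1 then trans (w k') (state_at q w k') else q.

Definition omega_act A (q : state A) (w : nat -> X) : nat -> X :=
  fun k => out (w k) (state_at q w k).

Definition omega_equiv A (p q : state A) : Prop :=
  forall w, omega_act p w =1 omega_act q w.

Definition omega_eqb A (p q : state A) : bool := `[< omega_equiv p q >].

Lemma omega_eqb_equiv A : equiv_class_of (@omega_eqb A).
Proof.
split=> [p | p q | q p r].
- exact/asboolP.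
- by apply/asboolP/asboolP => pq w k; rewrite pq.
- by move=> /asboolP pq /asboolP qr; apply/asboolP => w k; rewrite pq qr.
Qed.

Canonical omega_equiv_rel A := EquivRelPack (omega_eqb_equiv A).

(* [quot_type] equips the quotient with its [finType] structure. *)
Definition min_state A : finType := quot_type {eq_quot (@omega_eqb A)}.

Definition min_proj A (q : state A) : min_state A :=
  \pi_({eq_quot (@omega_eqb A)}) q.

Definition min_repr A (c : min_state A) : state A :=
  repr (c : {eq_quot (@omega_eqb A)}).

Definition minimal A : transducer X :=
  Transducer (min_state A)
    (fun x c => min_proj (trans x (min_repr c)))
    (fun x c => out x (min_repr c)).

Lemma min_stateP A (p q : state A) :
  min_proj p = min_proj q <-> omega_equiv p q.
Proof.
split=> [pq|pq]; first exact/asboolP/(eqmodP (@omega_equiv_rel A)).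
exact/eqmodP/asboolP.
Qed.

Lemma min_reprK A : cancel (@min_repr A) (@min_proj A).
Proof. exact: reprK. Qed.

Lemma omega_act_trans A (q : state A) x (w : nat -> X) k :
  omega_act (trans x q) w k =
  omega_act q (fun i => if i is j.+1 then w j else x) k.+1.
Proof.
rewrite /omega_act; congr out; elim: k => //= k ->; by case: k.
Qed.

Lemma minimal_out A x (q : state A) :
  out x (min_proj q : state (minimal A)) = out x q.
Proof.
have /min_stateP e := min_reprK (min_proj q).
exact: (e (fun=> x) 0).
Qed.

Lemma minimal_trans A x (q : state A) :
  trans x (min_proj q : state (minimal A)) =
  min_proj (trans x q).
Proof.
have /min_stateP e := min_reprK (min_proj q).
by apply/min_stateP => w k; rewrite !omega_act_trans e.
Qed.

Definition growth A (n : nat) : nat := #|state (minimal (tpow A n))|.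

End Transducers.

Definition cayley (G : finGroupType) : transducer G :=
  Transducer G (fun l m => (m * l)%g) (fun l m => (m * l)%g).

(* Main.v *)
Require Import Defs.
From mathcomp Require Import all_boot all_fingroup.

Set Implicit Arguments.
Unset Strict Implicit.
Unset Printing Implicit Defensive.

(** Adding a Cayley factor on the left preserves strong connectedness: a Cayley
    machine realises every output word and ends in the last letter that it has
    output.  Adding one on the right preserves reducedness: its state is its
    previous output, so from the second letter on the output of the product
    determines the output of the left factor, and the latter has injective
    transitions. *)

Section Transducers.

Variable X : finType.
Implicit Types A B : transducer X.

Definition reduced A := forall p q : state A, omega_equiv p q -> p = q.

Definition reversible A := forall x, injective (fun q : state A => trans x q).

Definition strongly_connected A := forall s t : state A, accessible s t.

(** An isomorphism of [A] onto a subtransducer of [B]. *)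
Definition embedding A B (f : state A -> state B) :=
  [/\ injective f, forall x q, f (trans x q) = trans x (f q)
    & forall x q, out x (f q) = out x q].

Lemma card_minimal A : reduced A -> #|state (minimal A)| = #|state A|.
Proof.
move=> redA; symmetry; apply: bij_eq_card (_ : bijective (@min_proj X A)).
exists (@min_repr X A); last exact: min_reprK.
by move=> q; apply/redA/min_stateP/min_reprK.
Qed.

Lemma embedding_state_at A B (f : state A -> state B) (q : state A) w k :
  embedding f -> f (state_at q w k) = state_at (f q) w k.
Proof. by case=> _ fT _; elim: k => //= k IH; rewrite fT IH. Qed.

Lemma embedding_reduced A B (f : state A -> state B) :
  embedding f -> reduced B -> reduced A.
Proof.
move=> fE redB p q pq; case: (fE) => finj _ fO; apply/finj/redB => w k.
by rewrite /omega_act -!embedding_state_at // !fO; apply: pq.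
Qed.

Lemma state_at_tprod A B (a : state A) (b : state B) w k :
  state_at ((a, b) : state (tprod A B)) w k =
  (state_at a w k, state_at b (omega_act a w) k).
Proof. by elim: k => //= k ->. Qed.

(** Once the left states agree, both right factors read the same letter. *)
Lemma tprod_reversible A B :
  reversible A -> reversible B -> reversible (tprod A B).
Proof.
move=> revA revB x [a b] [a' b'] /= [/revA ->].
by move=> /revB ->.
Qed.

Lemma tpow_reversible A n : reversible A -> reversible (tpow A n.+1).
Proof. by move=> revA; elim: n => [|n IH] //; apply: tprod_reversible. Qed.

Lemma card_tpow A n : #|state (tpow A n.+1)| = #|state A| ^ n.+1.
Proof.
elim: n => [|n IH]; first by rewrite expn1.
by rewrite expnS -IH -card_prod.
Qed.

(** Powers nest to the right, so a new factor appears on the left. Reassociation moves it to the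
    right end, where the induction for reducedness needs it. *)
Lemma tpowSr A n :
  exists f : state (tpow A n.+2) -> state (tprod (tpow A n.+1) A),
    embedding f.
Proof.
elim: n => [|n [f [finj fT fO]]]; first by exists id; split.
exists (fun pq => ((pq.1, (f pq.2).1), (f pq.2).2)); split.
- move=> [p q] [p' q'] /= [-> e1 e2]; congr pair.
  by apply: finj; case: (f q) (f q') e1 e2 => [? ?] [? ?] /= -> ->.
- by move=> x [p q]; have /= -> := fT (out x p) q.
- by move=> x [p q]; have /= := fO (out x p) q.
Qed.

End Transducers.

Section Cayley.

Variable G : finGroupType.
Local Open Scope group_scope.
Implicit Types B : transducer G.

Lemma cayley_reversible : reversible (cayley G).
Proof. by move=> x; apply: mulIg. Qed.

Lemma cayley_reduced : reduced (cayley G).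
Proof. by move=> p q /(_ (fun=> 1) 0) /mulIg. Qed.

Lemma cayley_strongly_connected : strongly_connected (cayley G).
Proof. by move=> s t; exists [:: s^-1 * t]; rewrite /= mulKVg. Qed.

(** In state [m] the letter [m^-1 * y] outputs [y] and leads to state [y], so any word [w] can be
    fed to [B]. *)
Lemma cayley_output B (w : seq G) (m : G) (b : state B) :
  accessible ((m, b) : state (tprod (cayley G) B))
             (last m w, foldl (fun q x => trans x q) b w).
Proof.
elim: w m b => [|y w IH] m b; first by exists [::].
have [v /= <-] := IH y (trans y b).
by exists (m^-1 * y :: v); rewrite /= mulKVg.
Qed.

Lemma tprod_cayley_strongly_connected B :
  reversible B -> strongly_connected B ->
  strongly_connected (tprod (cayley G) B).
Proof.
move=> revB conB [m b] [h c].
(* The last letter fed to [B] must be [h], so [B] is first driven to the preimage [g c] of [c] under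
   [h]; finiteness provides [g]. *)
have [g _ gK] := injF_bij (@revB h).
have [w wE] := conB b (g c).
have := cayley_output (rcons w h) m b.
by rewrite last_rcons foldl_rcons wE /= gK.
Qed.

Lemma tprod_cayley_reduced B :
  reversible B -> reduced B -> reduced (tprod B (cayley G)).
Proof.
move=> revB redB [b m] [c l] bc.
have outE (b0 : state B) (m0 : G) w k :
    omega_act ((b0, m0) : state (tprod B (cayley G))) w k =
    (state_at (m0 : state (cayley G)) (omega_act b0 w) k : G)
      * omega_act b0 w k.
  by rewrite {1}/omega_act state_at_tprod.
(* At time [k.+1] both Cayley states equal the common output at time [k], so they cancel on the
   left. *)
have tail w k : omega_act b w k.+1 = omega_act c w k.+1.
  have := bc w k.+1; rewrite !outE /=.
  by have := bc w k; rewrite !outE => -> /mulgI.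
have eq_bc : b = c.
  (* The successors of [b] and [c] under any fixed letter, here 1, act by these tails. *)
  apply: (@revB 1); apply: redB => w k.
  by rewrite !omega_act_trans tail.
by move: (bc (fun=> 1) 0); rewrite !outE eq_bc => /mulIg /= ->.
Qed.

Lemma tpow_cayley_reduced n : reduced (tpow (cayley G) n.+1).
Proof.
elim: n => [|n IH]; first exact: cayley_reduced.
have [f fE] := tpowSr (cayley G) n.
apply: embedding_reduced fE _; apply: tprod_cayley_reduced IH.
exact/tpow_reversible/cayley_reversible.
Qed.

Lemma tpow_cayley_strongly_connected n :
  strongly_connected (tpow (cayley G) n.+1).
Proof.
elim: n => [|n IH]; first exact: cayley_strongly_connected.
apply: tprod_cayley_strongly_connected IH.
exact/tpow_reversible/cayley_reversible.
Qed.

End Cayley.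

Theorem theorem6p18 (G : finGroupType) :
  (forall n : nat, 1 <= n ->
     #|state (minimal (tpow (cayley G) n))| = #|G| ^ n) /\
  (forall n : nat, 1 <= n -> growth (cayley G) n = #|G| ^ n) /\
  (forall n : nat, 1 <= n ->
     forall s t : state (tpow (cayley G) n), s <> t -> accessible s t).
Proof.
have cardE n : 1 <= n ->
    #|state (minimal (tpow (cayley G) n))| = #|G| ^ n.
  case: n => // n _.
  by rewrite card_minimal ?card_tpow //; apply: tpow_cayley_reduced.
(* [growth] unfolds to the cardinality in [cardE]. *)
split=> //; split=> // -[|n] // _ s t _.
exact: tpow_cayley_strongly_connected.
Qed.
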